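(* For every $\delta>0$ there is a constant $K_\delta>0$ such that for all integers $N\ge 1$, \[ \#3\mathrm{iet}(N)\;\ge\;\frac{17}{48\pi^2}N^4 - K_\delta N^{3+\delta}. \]
   Context: For $\varepsilon\in(0,1)\setminus\mathbb{Q}$ and $\ell$ with $\max\{\varepsilon,1-\varepsilon\}<\ell<1$, define $T_{\varepsilon,\ell}:[0,\ell)\to[0,\ell)$ by $T_{\varepsilon,\ell}(x)=x+1-\varepsilon$ on $I_A=[0,\ell-1+\varepsilon)$, $T_{\varepsilon,\ell}(x)=x+1-2\varepsilon$ on $I_B=[\ell-1+\varepsilon,\varepsilon)$, and $T_{\varepsilon,\ell}(x)=x-\varepsilon$ on $I_C=[\varepsilon,\ell)$. For $x_0\in[0,\ell)$, the 3iet word $u_{\varepsilon,\ell,x_0}=(u_n)_{n\in\mathbb{Z}}\in\{A,B,C\}^{\mathbb{Z}}$ is given by $u_n=X$ iff $T_{\varepsilon,\ell}^n(x_0)\in I_X$, $X\in\{A,B,C\}$. A 3iet factor is a finite word occurring (as a block of consecutive letters) in some 3iet word for some admissible $\varepsilon,\ell,x_0$. $3\mathrm{iet}(N)$ denotes the set of all 3iet factors of length $N$. *)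

(* Defs.v *)
From Stdlib Require Import Reals Lra List ZArith.
Open Scope R_scope.

Inductive letter : Set := LA | LB | LC.

Definition irrational (x : R) : Prop :=
  forall (p q : Z), q <> 0%Z -> x <> IZR p / IZR q.

Definition admissible (eps l : R) : Prop :=
  0 < eps < 1 /\ irrational eps /\ eps < l /\ 1 - eps < l /\ l < 1.

Definition T3 (eps l x : R) : R :=
  if Rlt_dec x (l - 1 + eps) then x + 1 - eps
  else if Rlt_dec x eps then x + 1 - 2 * eps
  else x - eps.

Definition code3 (eps l x : R) : letter :=
  if Rlt_dec x (l - 1 + eps) then LA
  else if Rlt_dec x eps then LB
  else LC.

Definition is_orbit (eps l x0 : R) (orb : Z -> R) : Prop :=
  orb 0%Z = x0 /\
  (forall n : Z, 0 <= orb n < l) /\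
  (forall n : Z, orb (n + 1)%Z = T3 eps l (orb n)).

Definition is_3iet_factor (w : list letter) : Prop :=
  exists eps l x0 (orb : Z -> R) (k : Z),
    admissible eps l /\ 0 <= x0 < l /\ is_orbit eps l x0 orb /\
    forall i : nat, (i < length w)%nat ->
      nth i w LA = code3 eps l (orb (k + Z.of_nat i)%Z).

Definition enumerates_3iet (N : nat) (ws : list (list letter)) : Prop :=
  NoDup ws /\
  forall w, In w ws <-> (is_3iet_factor w /\ length w = N).

(* Main.v *)
Require Import Defs.
From Stdlib Require Import Reals List Lra Lia ZArith Permutation.
Open Scope R_scope.

(** [T3] is the first return map to [[0, l)] of the rotation by [- eps], so every
    point of an orbit is [x + k - i * eps] for integers [k], [i] read off the word,
    and a word confines [eps] to an interval with rational endpoints.  Take [eps]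
    just above [p / q], with [q = p + p'], and follow one of the two
    discontinuities, [eps] or [l - 1 + eps].  The rotation is then a small
    perturbation of the one on [Z / q], and taking [l = (s - 1/2) / q], resp.
    [l = (s + 1/2) / q], makes the orbit come back across the discontinuity after
    exactly [s] steps of [T3], i.e. [q] turns.  A word of length [N]
    containing this crossing forces [eps > p / q] in all its realizations, hence
    determines [p / q]; it also determines the time [t] of the crossing, the return
    time [s], and which discontinuity was followed.  For every [s] there are about
    [(6 / PI^2) * s^2 / 2] coprime pairs [p, p' < s < p + p'] and [N - s] values of
    [t], which gives [24 / (48 PI^2) * N^4] words.  The surplus over [17 / 48] allows
    the density [6 / PI^2] to be replaced by the elementary bound
    [1 - 1/4 - sum_(odd d >= 3) 1/d^2 >= 1/2] and [PI] by [3]. *)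

(** * Irrational numbers *)

(** Infinite descent: both numbers are even, and halving them gives a smaller solution. *)
Lemma two_mul_square_eq_square (a b : nat) :
  (a * a = 2 * (b * b))%nat -> b = 0%nat.
Proof.
  revert b; induction a as [a IH] using (well_founded_induction lt_wf); intros b H.
  destruct (Nat.Even_or_Odd a) as [[c Hc]|[c Hc]]; [|lia].
  destruct (Nat.Even_or_Odd b) as [[d Hd]|[d Hd]]; [|subst; lia].
  destruct (Nat.eq_dec b 0) as [|Hb]; [assumption|].
  enough (d = 0%nat) by lia.
  apply (IH c); [|subst; lia].
  destruct a; [nia|lia].
Qed.

Lemma irrational_sqrt2 : irrational (sqrt 2).
Proof.
  intros p q Hq H.
  assert (Hq' : IZR q <> 0) by (apply not_0_IZR; exact Hq).
  assert (E : IZR p * IZR p = 2 * (IZR q * IZR q)).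
  { rewrite <- (sqrt_sqrt 2) by lra. rewrite H. field. exact Hq'. }
  rewrite <- !mult_IZR in E. apply eq_IZR in E.
  apply Hq.
  enough (Z.abs_nat q = 0%nat) by lia.
  apply (two_mul_square_eq_square (Z.abs_nat p)). nia.
Qed.

(** For [x = sqrt 2] this provides irrational values of [eps] as close as desired to a given
    fraction. *)
Lemma irrational_affine (x : R) (a b c d : Z) :
  b <> 0%Z -> c <> 0%Z -> d <> 0%Z -> irrational x ->
  irrational (IZR a / IZR b + IZR c / IZR d * x).
Proof.
  intros Hb Hc Hd Hx p q Hq H.
  apply (Hx ((p * b - a * q) * d)%Z (q * b * c)%Z); [nia|].
  apply not_0_IZR in Hb. apply not_0_IZR in Hc. apply not_0_IZR in Hd.
  apply not_0_IZR in Hq.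
  rewrite !mult_IZR, minus_IZR, !mult_IZR.
  replace x with ((IZR p / IZR q - IZR a / IZR b) * (IZR d / IZR c)).
  - field; auto.
  - rewrite <- H. field; auto.
Qed.

(** [1] and [x] are linearly independent over the rationals. A displacement along an orbit therefore
    determines its numbers of wraps and of turns. *)
Lemma irrational_linear_inj (x : R) (a b c d : Z) :
  irrational x -> IZR a - IZR b * x = IZR c - IZR d * x -> a = c /\ b = d.
Proof.
  intros Hx H.
  destruct (Z.eq_dec b d) as [<-|Hbd].
  - split; [apply eq_IZR; lra | reflexivity].
  - exfalso. apply (Hx (a - c)%Z (b - d)%Z); [lia|].
    assert (IZR b - IZR d <> 0) by (rewrite <- minus_IZR; apply not_0_IZR; lia).
    rewrite !minus_IZR. apply Rmult_eq_reg_r with (IZR b - IZR d); [|assumption].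
    field_simplify; [lra|assumption].
Qed.

(** * Two-sided orbits of the exchange *)

(** Orbits run over all of [Z], so [T3] has to be inverted. From left to right, [[0, l)] is tiled by
    the images of the intervals of [LC], [LB] and [LA]. *)
Definition T3_inv (eps l y : R) : R :=
  if Rlt_dec y (l - eps) then y + eps
  else if Rlt_dec y (1 - eps) then y - 1 + 2 * eps
  else y - 1 + eps.

Section Orbits.

Variables eps l : R.
Hypothesis adm : admissible eps l.

Lemma T3_range (x : R) : 0 <= x < l -> 0 <= T3 eps l x < l.
Proof.
  destruct adm as (? & _ & ? & ? & ?).
  intros Hx; unfold T3.
  destruct (Rlt_dec _ _); [lra|]; destruct (Rlt_dec _ _); lra.
Qed.

Lemma T3_inv_range (y : R) : 0 <= y < l -> 0 <= T3_inv eps l y < l.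
Proof.
  destruct adm as (? & _ & ? & ? & ?).
  intros Hy; unfold T3_inv.
  destruct (Rlt_dec _ _); [lra|]; destruct (Rlt_dec _ _); lra.
Qed.

Lemma T3_T3_inv (y : R) : 0 <= y < l -> T3 eps l (T3_inv eps l y) = y.
Proof.
  destruct adm as (? & _ & ? & ? & ?).
  intros Hy; unfold T3, T3_inv.
  repeat destruct (Rlt_dec _ _); lra.
Qed.

Definition orbit_of (x : R) (n : Z) : R :=
  if (0 <=? n)%Z then Nat.iter (Z.to_nat n) (T3 eps l) x
  else Nat.iter (Z.to_nat (- n)) (T3_inv eps l) x.

Lemma orbit_of_range (x : R) (n : Z) : 0 <= x < l -> 0 <= orbit_of x n < l.
Proof.
  intros Hx; unfold orbit_of.
  destruct (0 <=? n)%Z.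
  - induction (Z.to_nat n); [exact Hx | apply T3_range; assumption].
  - induction (Z.to_nat (- n)); [exact Hx | apply T3_inv_range; assumption].
Qed.

Lemma is_orbit_orbit_of (x : R) : 0 <= x < l -> is_orbit eps l x (orbit_of x).
Proof.
  intros Hx; split; [reflexivity|split].
  - intros n; apply orbit_of_range; exact Hx.
  - intros n. destruct (Z.leb_spec 0 n) as [Hn|Hn].
    + unfold orbit_of.
      rewrite (proj2 (Z.leb_le 0 n)), (proj2 (Z.leb_le 0 (n + 1))) by lia.
      replace (Z.to_nat (n + 1)) with (S (Z.to_nat n)) by lia. reflexivity.
    + assert (E : orbit_of x n = T3_inv eps l (orbit_of x (n + 1))).
      { unfold orbit_of. rewrite (proj2 (Z.leb_gt 0 n)) by lia.
        replace (Z.to_nat (- n)) with (S (Z.to_nat (- (n + 1)))) by lia.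
        (* The two branches of [orbit_of] meet only at [n = -1]. *)
        destruct (Z.leb_spec 0 (n + 1)); [|reflexivity].
        replace n with (-1)%Z by lia. reflexivity. }
      rewrite E. symmetry. apply T3_T3_inv, orbit_of_range, Hx.
Qed.

End Orbits.

(** * Displacements along a word *)

(* [T3] adds [wrap a] and subtracts [step a * eps] at a point coded by [a];
   [step] is the number of turns of the rotation by [- eps] on [0, 1). *)
Definition step (a : letter) : Z := match a with LB => 2 | _ => 1 end.
Definition wrap (a : letter) : Z := match a with LC => 0 | _ => 1 end.

(** Past the end of [w] the default letter [LA] still counts one turn, so [steps w] is strictly
    increasing on all of [nat]. *)
Fixpoint steps (w : list letter) (n : nat) : Z :=
  match n with 0%nat => 0 | S m => steps w m + step (nth m w LA) end.
Fixpoint wraps (w : list letter) (n : nat) : Z :=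
  match n with 0%nat => 0 | S m => wraps w m + wrap (nth m w LA) end.

Lemma steps_lt (w : list letter) (m n : nat) :
  (m < n)%nat -> (steps w m < steps w n)%Z.
Proof.
  induction 1 as [|n H IH]; simpl.
  - destruct (nth m w LA); simpl; lia.
  - destruct (nth n w LA); simpl; lia.
Qed.

Lemma steps_inj (w : list letter) (m n : nat) : steps w m = steps w n -> m = n.
Proof.
  intros H. destruct (Nat.lt_total m n) as [E|[E|E]]; [|exact E|];
    apply (steps_lt w) in E; lia.
Qed.

Lemma steps_bounds (w : list letter) (n : nat) :
  (0 <= steps w n <= 2 * Z.of_nat n)%Z.
Proof.
  induction n as [|n IH]; [simpl; lia|].
  cbn [steps]; destruct (nth n w LA); cbn [step]; lia.
Qed.

Definition realizes (eps l : R) (y : nat -> R) (w : list letter) : Prop :=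
  forall i, (i < length w)%nat ->
    0 <= y i < l /\ y (S i) = T3 eps l (y i) /\ nth i w LA = code3 eps l (y i).

Lemma realizes_position (eps l : R) (y : nat -> R) (w : list letter) (n : nat) :
  realizes eps l y w -> (n <= length w)%nat ->
  y n = y 0%nat + IZR (wraps w n) - IZR (steps w n) * eps.
Proof.
  intros Hw; induction n as [|n IH]; intros Hn; [simpl; lra|].
  destruct (Hw n Hn) as (_ & HT & Hc).
  cbn [wraps steps]. rewrite HT, Hc, !plus_IZR.
  assert (E := IH ltac:(lia)). unfold T3, code3.
  destruct (Rlt_dec _ _); [|destruct (Rlt_dec _ _)]; simpl; lra.
Qed.

Lemma realizes_displacement (eps l : R) (y : nat -> R) (w : list letter) (m n : nat) :
  realizes eps l y w -> (m <= length w)%nat -> (n <= length w)%nat ->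
  y n - y m = IZR (wraps w n - wraps w m) - IZR (steps w n - steps w m) * eps.
Proof.
  intros Hw Hm Hn.
  rewrite (realizes_position _ _ _ _ m Hw Hm), (realizes_position _ _ _ _ n Hw Hn).
  rewrite !minus_IZR. lra.
Qed.

(** * Crossings of a discontinuity *)

(** The boundary between [LB] and [LC] for [true], between [LA] and [LB] for [false]. *)
Definition jump (b : bool) (eps l : R) : R := if b then eps else l - 1 + eps.

Definition below (b : bool) (a : letter) : bool :=
  match a with LA => true | LB => b | LC => false end.

Lemma below_code3 (b : bool) (eps l x : R) :
  l < 1 -> below b (code3 eps l x) = true <-> x < jump b eps l.
Proof.
  intros Hl; unfold code3, jump.
  destruct (Rlt_dec _ _); [|destruct (Rlt_dec _ _)]; destruct b; simpl;
    split; intros; try discriminate; try reflexivity; lra.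
Qed.

(* The orbit returns across the discontinuity [jump b] after [q] turns, from
   right to left. *)
Definition crossing (w : list letter) (b : bool) (p q : Z) (t n : nat) : Prop :=
  (t + n < length w)%nat /\
  (wraps w (t + n) - wraps w t = p)%Z /\ (steps w (t + n) - steps w t = q)%Z /\
  below b (nth t w LA) = false /\ below b (nth (t + n) w LA) = true.

(** A crossing moves the point by [p - q * eps]. To end on the left of the discontinuity it must
    start less than [q * eps - p] to the right of it, and this window is nonempty only if
    [q * eps > p]. *)
Lemma crossing_position (eps l : R) (y : nat -> R) w b p q t n :
  l < 1 -> realizes eps l y w -> crossing w b p q t n ->
  jump b eps l <= y t < jump b eps l + IZR q * eps - IZR p.
Proof.
  intros Hl Hw (Hn & Hp & Hq & H1 & H2).
  assert (D := realizes_displacement _ _ _ _ t (t + n) Hw ltac:(lia) ltac:(lia)).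
  rewrite Hp, Hq in D.
  destruct (Hw t ltac:(lia)) as (_ & _ & E1).
  destruct (Hw (t + n)%nat ltac:(lia)) as (_ & _ & E2).
  rewrite E2 in H2. apply below_code3 in H2; [|exact Hl].
  assert (~ y t < jump b eps l).
  { rewrite <- below_code3 by exact Hl. rewrite <- E1, H1. discriminate. }
  lra.
Qed.

(** * First return of a rotation *)

Fixpoint count (f : nat -> bool) (n : nat) : nat :=
  match n with 0%nat => 0%nat | S m => (count f m + if f m then 1 else 0)%nat end.

(** [rho] is an orbit of the rotation by [- eps] on [[0, 1)] and [f] marks its visits to [[0, l)].
    The number of earlier visits converts rotation time into time for [T3]. *)
Lemma first_return (eps l : R) (y rho : nat -> R) (f : nat -> bool) (q : nat) :
  admissible eps l ->
  (forall n, y (S n) = T3 eps l (y n)) ->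
  rho 0%nat = y 0%nat -> y 0%nat < l ->
  (forall i, (i < q)%nat ->
     rho (S i) = if Rlt_dec (rho i) eps then rho i + 1 - eps else rho i - eps) ->
  (forall i, (i < q)%nat -> rho i < 1) ->
  (forall i, (i < q)%nat -> f i = true <-> rho i < l) ->
  rho q < l -> y (count f q) = rho q.
Proof.
  intros (Heps & _ & Hl1 & Hl2 & Hl3) HT H0 Hy0 Hrot Hlt Hf Hq.
  enough (G : forall i, (i <= q)%nat -> rho i < l -> y (count f i) = rho i)
    by (apply G; auto).
  clear Hq.
  induction i as [i IH] using (well_founded_induction lt_wf); intros Hi Hrho.
  destruct i as [|i]; [symmetry; exact H0|].
  assert (Ri := Hrot i ltac:(lia)).
  cbn [count].
  destruct (f i) eqn:Fi.
  - apply Hf in Fi; [|lia].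
    rewrite Nat.add_1_r, HT, (IH i) by (lia || lra).
    unfold T3. repeat destruct (Rlt_dec _ _); lra.
  - assert (Hge : ~ rho i < l).
    { rewrite <- Hf by lia. rewrite Fi. discriminate. }
    (* The point before the current one is outside [[0, l)], hence not the starting point. Its own
       predecessor lies below [eps], because a turn from the right of [eps] ends below
       [1 - eps < l]. The two turns together are one step of [T3] coded by [LB]. *)
    destruct i as [|i]; [lra|].
    assert (Ri' := Hrot i ltac:(lia)). assert (Li := Hlt i ltac:(lia)).
    destruct (Rlt_dec (rho i) eps) as [Hr|Hr]; [|lra].
    destruct (Rlt_dec (rho (S i)) eps); [lra|].
    cbn [count].
    rewrite (proj2 (Hf i ltac:(lia))) by lra.
    rewrite Nat.add_0_r, Nat.add_1_r, HT, (IH i) by (lia || lra).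
    unfold T3. repeat destruct (Rlt_dec _ _); lra.
Qed.

(** * Visits of a rational rotation *)

Lemma count_filter (f : nat -> bool) (n : nat) : count f n = length (filter f (seq 0 n)).
Proof.
  induction n as [|n IH]; [reflexivity|].
  rewrite seq_S, filter_app, length_app, <- IH. simpl. destruct (f n); reflexivity.
Qed.

Lemma Permutation_filter {A} (f : A -> bool) (l l' : list A) :
  Permutation l l' -> Permutation (filter f l) (filter f l').
Proof.
  induction 1; simpl.
  - constructor.
  - destruct (f x); auto.
  - destruct (f x), (f y); auto using Permutation_refl, perm_swap.
  - etransitivity; eassumption.
Qed.

(** The rotation by [- p / q] scaled by [q = p + p'], so that [1 - p / q] becomes [p']. *)
Fixpoint residue (p p' g0 : Z) (i : nat) : Z :=
  match i with
  | 0%nat => g0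
  | S j => let g := residue p p' g0 j in if (g <? p)%Z then g + p' else g - p
  end.

Section Residues.

Variables p p' g0 : Z.
Hypothesis p_pos : (0 < p)%Z.
Hypothesis p'_pos : (0 < p')%Z.
Hypothesis g0_range : (0 <= g0 < p + p')%Z.
Hypothesis coprime : Z.gcd p p' = 1%Z.

Lemma residue_range i : (0 <= residue p p' g0 i < p + p')%Z.
Proof.
  induction i as [|i IH]; [exact g0_range|].
  cbn [residue]; cbv zeta. destruct (Z.ltb_spec (residue p p' g0 i) p); lia.
Qed.

Lemma residue_congruence i :
  exists k, (residue p p' g0 i = g0 + Z.of_nat i * p' - k * (p + p'))%Z.
Proof.
  induction i as [|i [k Hk]]; [exists 0%Z; simpl; lia|].
  cbn [residue]; cbv zeta. destruct (Z.ltb_spec (residue p p' g0 i) p).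
  - exists k. lia.
  - exists (k + 1)%Z. lia.
Qed.

(** Every turn adds [p'] modulo [p + p'], and [p'] is invertible there. *)
Lemma residue_inj i j :
  (i < j)%nat -> (Z.of_nat j < p + p')%Z -> residue p p' g0 i <> residue p p' g0 j.
Proof.
  intros Hij Hj E.
  destruct (residue_congruence i) as [k Hk], (residue_congruence j) as [k' Hk'].
  assert (D : (p + p' | p' * (Z.of_nat j - Z.of_nat i))%Z) by (exists (k' - k)%Z; lia).
  apply Z.gauss in D.
  - apply Z.divide_pos_le in D; lia.
  - rewrite Z.gcd_comm, Z.gcd_add_diag_r, Z.gcd_comm. exact coprime.
Qed.

(** One period meets each residue exactly once, so exactly [s] of the visits are below [s]. This is
    why [q] turns will amount to [s] steps of [T3]. *)
Lemma count_residue_lt (s : nat) :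
  (Z.of_nat s <= p + p')%Z ->
  count (fun i => residue p p' g0 i <? Z.of_nat s)%Z (Z.to_nat (p + p')) = s.
Proof.
  intros Hs. set (q := Z.to_nat (p + p')). rewrite count_filter.
  set (g := fun i => Z.to_nat (residue p p' g0 i)).
  assert (P : Permutation (map g (seq 0 q)) (seq 0 q)).
  { apply NoDup_Permutation_bis.
    - apply NoDup_map_NoDup_ForallPairs; [|apply seq_NoDup].
      intros i j Hi Hj E. apply in_seq in Hi, Hj. unfold g in E.
      assert (Ri := residue_range i). assert (Rj := residue_range j).
      destruct (Nat.lt_total i j) as [H|[H|H]]; [exfalso| exact H|exfalso].
      + apply (residue_inj i j); lia.
      + apply (residue_inj j i); lia.
    - rewrite length_map. reflexivity.
    - intros x Hx. apply in_map_iff in Hx as (i & <- & _).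
      apply in_seq. assert (R := residue_range i). unfold g, q. lia. }
  transitivity (length (filter (fun x => x <? s)%nat (map g (seq 0 q)))).
  - rewrite <- (length_map g). f_equal. clear P.
    induction (seq 0 q) as [|i r IH]; [reflexivity|]. simpl.
    assert (R := residue_range i).
    destruct (Z.ltb_spec (residue p p' g0 i) (Z.of_nat s)), (Nat.ltb_spec (g i) s);
      try (unfold g in *; lia); simpl; congruence.
  - assert (P' : Permutation (filter (fun x => x <? s)%nat (map g (seq 0 q)))
                   (filter (fun x => x <? s)%nat (seq 0 q))).
    { apply Permutation_filter, P. }
    rewrite (Permutation_length P').
    replace q with (s + (q - s))%nat by (unfold q; lia).
    rewrite seq_app, filter_app, length_app.
    rewrite (forallb_filter_id _ (seq 0 s)).
    + rewrite length_seq.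
      enough (filter (fun x => x <? s)%nat (seq (0 + s) (q - s)) = nil) as -> by (simpl; lia).
      induction (q - s)%nat as [|m IH]; [reflexivity|].
      rewrite seq_S, filter_app, IH. simpl.
      destruct (Nat.ltb_spec (s + m) s); [lia|reflexivity].
    + apply forallb_forall. intros x Hx. apply in_seq in Hx. apply Nat.ltb_lt. lia.
Qed.

End Residues.

Lemma residue_period (p p' g0 : Z) :
  (0 < p)%Z -> (0 < p')%Z -> (0 <= g0 < p + p')%Z ->
  residue p p' g0 (Z.to_nat (p + p')) = g0.
Proof.
  intros Hp Hp' Hg.
  assert (R := residue_range p p' g0 Hp Hp' Hg (Z.to_nat (p + p'))).
  destruct (residue_congruence p p' g0 (Z.to_nat (p + p'))) as [k Hk].
  rewrite Z2Nat.id in Hk by lia.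
  (* The residue differs from [g0] by a multiple of the modulus, and both lie in the same period, so
     [k = p']. *)
  assert (k < p' + 1)%Z by (apply Z.mul_lt_mono_pos_r with (p + p')%Z; lia).
  assert (p' - 1 < k)%Z by (apply Z.mul_lt_mono_pos_r with (p + p')%Z; lia).
  replace k with p' in Hk by lia. lia.
Qed.

(** * Words with a prescribed crossing *)

Lemma Rdiv_lt_iff (a b c : R) : 0 < c -> a / c < b / c <-> a < b.
Proof.
  intros Hc; split; intros H.
  - apply Rmult_lt_reg_r with (/ c); [apply Rinv_0_lt_compat|]; assumption.
  - apply Rmult_lt_compat_r; [apply Rinv_0_lt_compat|]; assumption.
Qed.

(** Irrational, and small even against a product of two denominators up to [2 * N]:
    [4 * sqrt 2 / 100 < 1 / 10]. *)
Definition tilt (N : nat) : R := 1 / IZR (100 * Z.of_nat N ^ 2) * sqrt 2.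

Lemma tilt_pos (N : nat) : (1 <= N)%nat -> 0 < tilt N.
Proof.
  intros HN. apply Rmult_lt_0_compat.
  - apply Rdiv_lt_0_compat; [lra|apply IZR_lt; nia].
  - apply sqrt_lt_R0; lra.
Qed.

Lemma tilt_small (N : nat) (z : Z) :
  (1 <= N)%nat -> (z <= 4 * Z.of_nat N ^ 2)%Z -> IZR z * tilt N <= 1 / 10.
Proof.
  intros HN Hz.
  assert (P := tilt_pos N HN).
  apply Rle_trans with (IZR (4 * Z.of_nat N ^ 2) * tilt N).
  { apply Rmult_le_compat_r; [lra|apply IZR_le, Hz]. }
  unfold tilt. rewrite !mult_IZR.
  assert (0 < IZR (Z.of_nat N ^ 2)) by (apply IZR_lt; nia).
  assert (sqrt 2 <= 2).
  { rewrite <- (sqrt_Rsqr 2) at 2 by lra. apply sqrt_le_1_alt. unfold Rsqr. lra. }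
  replace (4 * IZR (Z.of_nat N ^ 2) * (1 / (100 * IZR (Z.of_nat N ^ 2)) * sqrt 2))
    with (sqrt 2 / 25) by (field; lra).
  lra.
Qed.

Definition tip_eps (N : nat) (p q : Z) : R := IZR p / IZR q + tilt N.
Definition tip_len (b : bool) (s : nat) (q : Z) : R :=
  (INR s + if b then - (1 / 2) else 1 / 2) / IZR q.

Definition tip_point (N : nat) (b : bool) (p p' : Z) (s : nat) : R :=
  jump b (tip_eps N p (p + p')) (tip_len b s (p + p')).

Definition tip_orbit (N : nat) (b : bool) (p p' : Z) (s : nat) : Z -> R :=
  orbit_of (tip_eps N p (p + p')) (tip_len b s (p + p')) (tip_point N b p p' s).

(** The window is shifted so that the starting point, on the discontinuity, has index [t] in the
    word. *)
Definition tip_word (N : nat) (b : bool) (p p' : Z) (s t : nat) : list letter :=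
  map (fun i => code3 (tip_eps N p (p + p')) (tip_len b s (p + p'))
                  (tip_orbit N b p p' s (Z.of_nat i - Z.of_nat t))) (seq 0 N).

(** [p, p' < s < p + p'] is the admissibility condition for [eps] near [p / q] and [l] near [s / q];
    [t + s < N] places the return inside the word. *)
Definition valid (N : nat) (p p' : Z) (s t : nat) : Prop :=
  (0 < p < Z.of_nat s)%Z /\ (0 < p' < Z.of_nat s)%Z /\ (Z.of_nat s < p + p')%Z /\
  Z.gcd p p' = 1%Z /\ (t + s < N)%nat.

Section TipWord.

Variables (N : nat) (b : bool) (p p' : Z) (s t : nat).
Hypothesis V : valid N p p' s t.

Let q : Z := (p + p')%Z.
Let eps : R := tip_eps N p q.
Let l : R := tip_len b s q.
Let e : R := IZR q * tilt N.
Let y (i : nat) : R := tip_orbit N b p p' s (Z.of_nat i - Z.of_nat t).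

Lemma tip_q_pos : 0 < IZR q.
Proof. apply IZR_lt. unfold q. destruct V. lia. Qed.

Lemma tip_e_bounds : 0 < e <= 1 / 10.
Proof.
  destruct V as (? & ? & ? & _ & ?). split.
  - apply Rmult_lt_0_compat; [apply tip_q_pos|apply tilt_pos; lia].
  - apply tilt_small; unfold q; nia.
Qed.

Lemma tip_eps_eq : eps = (IZR p + e) / IZR q.
Proof. unfold eps, tip_eps, e. field. apply Rgt_not_eq, tip_q_pos. Qed.

(** In units of [1 / q], the integers being compared differ by at least 1, which absorbs both the
    half in [l] and the offset [e <= 1 / 10]. *)
Lemma tip_admissible : admissible eps l.
Proof.
  assert (Q := tip_q_pos). assert (E := tip_e_bounds).
  destruct V as (Hp & Hp' & Hs & _ & Ht).
  assert (IZR 1 <= IZR p) by (apply IZR_le; lia).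
  assert (IZR p + 1 <= INR s) by (rewrite INR_IZR_INZ, <- plus_IZR; apply IZR_le; lia).
  assert (IZR p' + 1 <= INR s) by (rewrite INR_IZR_INZ, <- plus_IZR; apply IZR_le; lia).
  assert (INR s + 1 <= IZR q) by (rewrite INR_IZR_INZ, <- plus_IZR; apply IZR_le; unfold q; lia).
  assert (Eq : IZR q = IZR p + IZR p') by (unfold q; apply plus_IZR).
  assert (O : 1 = IZR q / IZR q) by (field; lra).
  unfold admissible, l, tip_len. rewrite tip_eps_eq.
  repeat split.
  - apply Rdiv_lt_0_compat; lra.
  - apply Rlt_le_trans with (IZR q / IZR q); [apply Rdiv_lt_iff; lra|lra].
  - rewrite <- tip_eps_eq. unfold eps, tip_eps, tilt.
    apply irrational_affine; [unfold q; lia|lia|nia|apply irrational_sqrt2].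
  - apply Rdiv_lt_iff; [exact Q|]. destruct b; lra.
  - replace (1 - (IZR p + e) / IZR q) with ((IZR q - (IZR p + e)) / IZR q) by (field; lra).
    apply Rdiv_lt_iff; [exact Q|]. destruct b; lra.
  - apply Rlt_le_trans with (IZR q / IZR q); [|lra].
    apply Rdiv_lt_iff; [exact Q|]. destruct b; lra.
Qed.

Lemma tip_point_range : 0 <= tip_point N b p p' s < l.
Proof.
  destruct tip_admissible as (? & _ & ? & ? & ?).
  unfold tip_point. fold q eps l. unfold jump. destruct b; lra.
Qed.

Lemma tip_word_length : length (tip_word N b p p' s t) = N.
Proof. unfold tip_word. rewrite length_map. apply length_seq. Qed.

Lemma tip_word_nth i : (i < N)%nat -> nth i (tip_word N b p p' s t) LA = code3 eps l (y i).
Proof.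
  intros Hi. unfold tip_word.
  rewrite nth_indep with (d' := code3 eps l (y 0%nat))
    by (rewrite length_map, length_seq; exact Hi).
  rewrite (map_nth (fun i => code3 eps l (y i))). rewrite seq_nth by exact Hi. reflexivity.
Qed.

Lemma tip_orbit_is_orbit : is_orbit eps l (tip_point N b p p' s) (tip_orbit N b p p' s).
Proof. apply is_orbit_orbit_of; [apply tip_admissible|apply tip_point_range]. Qed.

Lemma tip_word_realizes : realizes eps l y (tip_word N b p p' s t).
Proof.
  intros i Hi. rewrite tip_word_length in Hi.
  destruct tip_orbit_is_orbit as (_ & O1 & O2).
  split; [apply O1|split].
  - unfold y. rewrite <- O2. f_equal. lia.
  - apply tip_word_nth, Hi.
Qed.

Lemma tip_word_factor : is_3iet_factor (tip_word N b p p' s t).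
Proof.
  exists eps, l, (tip_point N b p p' s), (tip_orbit N b p p' s), (- Z.of_nat t)%Z.
  split; [apply tip_admissible|].
  split; [apply tip_point_range|].
  split; [apply tip_orbit_is_orbit|].
  intros i Hi. rewrite tip_word_length in Hi.
  rewrite tip_word_nth by exact Hi. unfold y. do 2 f_equal. lia.
Qed.

Lemma tip_word_start : y t = jump b eps l.
Proof.
  unfold y. rewrite Z.sub_diag. apply tip_orbit_is_orbit.
Qed.

(** In units of [1 / q] the rotation follows the orbit of residues and drifts down by [e] per turn.
    The total drift is too small to change which residues count as below [eps] or [l], so after [q]
    turns, that is [s] visible points, the orbit is back at its start moved left by [e]. *)
Lemma tip_word_return : y (t + s) = jump b eps l + IZR p - IZR q * eps.
Proof.
  assert (Q := tip_q_pos). assert (E := tip_e_bounds).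
  assert (A := tip_admissible).
  destruct V as (Hp & Hp' & Hs & Hgcd & Ht).
  assert (Eq : IZR q = IZR p + IZR p') by (unfold q; apply plus_IZR).
  (* Integer and half-integer parts of [q] times the discontinuity: [q * eps = p + e], and
     [q * (l - 1 + eps) = s - p' + 1 / 2 + e] when [b] is [false]. *)
  set (g0 := if b then p else (Z.of_nat s - p')%Z).
  set (h := if b then 0 else 1 / 2).
  assert (Hg0 : (0 <= g0 < p + p')%Z) by (unfold g0; destruct b; lia).
  set (g := residue p p' g0).
  set (rho := fun i => (IZR (g i) + h + e - INR i * e) / IZR q).
  assert (Hr0 : rho 0%nat = jump b eps l).
  { unfold rho, jump, l, tip_len. rewrite tip_eps_eq. unfold g, g0, h. simpl.
    rewrite INR_IZR_INZ. destruct b.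
    - field; lra.
    - rewrite minus_IZR, Eq. field; lra. }
  assert (He : forall i, (i < Z.to_nat q)%nat -> 0 <= INR i * e <= 1 / 10).
  { intros i Hi. split.
    - apply Rmult_le_pos; [apply pos_INR|lra].
    - unfold e. rewrite <- Rmult_assoc, INR_IZR_INZ, <- mult_IZR.
      apply tilt_small; unfold q in *; nia. }
  assert (Hg : forall i, (0 <= g i < q)%Z) by (intros i; apply residue_range; lia).
  assert (Heps : forall i, (i < Z.to_nat q)%nat -> rho i < eps <-> (g i < p)%Z).
  { intros i Hi. rewrite tip_eps_eq. unfold rho. rewrite Rdiv_lt_iff by exact Q.
    assert (Ei := He i Hi). destruct (Z.lt_ge_cases (g i) p) as [H|H].
    - split; [tauto|intros _]. apply Zlt_le_succ, IZR_le in H. rewrite succ_IZR in H.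
      unfold h; destruct b; lra.
    - split; [intros H1; exfalso|lia]. unfold h in H1.
      destruct b eqn:Hb; [|apply IZR_le in H; lra].
      (* The residue [p] would be misjudged after any downward drift, but it occurs only at time 0,
         exactly on [eps]. *)
      destruct (Z.eq_dec (g i) p) as [Hgi|Hgi].
      + destruct i as [|i]; [simpl in H1; apply IZR_le in H; lra|].
        apply (residue_inj p p' g0 Hgcd 0 (S i)); [lia|unfold q in Hi; lia|].
        fold g. rewrite Hgi. reflexivity.
      + assert (H2 : (p + 1 <= g i)%Z) by lia.
        apply IZR_le in H2. rewrite plus_IZR in H2. lra. }
  assert (Hvis : forall i, (i < Z.to_nat q)%nat ->
            (g i <? Z.of_nat s)%Z = true <-> rho i < l).
  { intros i Hi. unfold rho, l, tip_len. rewrite Rdiv_lt_iff by exact Q.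
    assert (Ei := He i Hi). rewrite (INR_IZR_INZ s).
    destruct (Z.ltb_spec (g i) (Z.of_nat s)) as [H|H].
    - split; [intros _|reflexivity]. apply Zlt_le_succ, IZR_le in H. rewrite succ_IZR in H.
      unfold h; destruct b; lra.
    - split; [discriminate|intros H1; exfalso].
      unfold h in H1. destruct b eqn:Hb; [apply IZR_le in H; lra|].
      destruct (Z.eq_dec (g i) (Z.of_nat s)) as [Hgi|Hgi].
      (* The residue [s] is the delicate one: it occurs at time 1, where the drift has just
         cancelled [e] and the point equals [l], and never again in the period. *)
      + assert (G1 : g 1%nat = Z.of_nat s).
        { unfold g. cbn [residue]. cbv zeta. unfold g0.
          destruct (Z.ltb_spec (Z.of_nat s - p') p); lia. }
        apply IZR_le in H. destruct i as [|[|i]]; [simpl in H1; lra|simpl in H1; lra|].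
        apply (residue_inj p p' g0 Hgcd 1 (S (S i))); [lia|unfold q in Hi; lia|].
        fold g. congruence.
      + assert (H2 : (Z.of_nat s + 1 <= g i)%Z) by lia.
        apply IZR_le in H2. rewrite plus_IZR in H2. lra. }
  assert (Hrq : rho (Z.to_nat q) = jump b eps l + IZR p - IZR q * eps).
  { rewrite <- Hr0. unfold rho, g, q. rewrite residue_period by lia. fold q.
    rewrite tip_eps_eq, INR_IZR_INZ, Z2Nat.id by (unfold q; lia). simpl. field; lra. }
  rewrite <- Hrq.
  (* Writes [s] as the number of visits in one period, the form produced by [first_return]. *)
  rewrite <- (count_residue_lt p p' g0 ltac:(lia) ltac:(lia) Hg0 Hgcd s ltac:(lia)) at 1.
  fold q g.
  apply (first_return eps l (fun n => y (t + n)) rho _ (Z.to_nat q) A).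
  - intros n. rewrite Nat.add_succ_r. unfold y.
    rewrite <- (proj2 (proj2 tip_orbit_is_orbit)). f_equal. lia.
  - rewrite Nat.add_0_r, tip_word_start. exact Hr0.
  - rewrite Nat.add_0_r, tip_word_start. apply tip_point_range.
  - intros i Hi. specialize (Heps i Hi).
    unfold rho, g. cbn [residue]. cbv zeta. fold g.
    rewrite tip_eps_eq in Heps |- *.
    destruct (Z.ltb_spec (g i) p) as [H|H]; destruct (Rlt_dec _ _) as [H'|H'].
    + rewrite S_INR, plus_IZR. field_simplify_eq; [rewrite Eq; ring|lra].
    + exfalso. apply H', Heps, H.
    + exfalso. apply Heps in H'. lia.
    + rewrite S_INR, minus_IZR. field; lra.
  - intros i Hi. destruct (Hg i) as [_ H]. apply Zlt_le_succ, IZR_le in H.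
    rewrite succ_IZR in H. specialize (He i Hi).
    apply Rlt_le_trans with (IZR q / IZR q); [|right; field; lra].
    apply Rdiv_lt_iff; [exact Q|]. unfold h; destruct b; lra.
  - exact Hvis.
  - rewrite Hrq. assert (P := tip_point_range). unfold tip_point in P. fold q eps l in P.
    rewrite tip_eps_eq in P |- *.
    replace (IZR q * ((IZR p + e) / IZR q)) with (IZR p + e) by (field; lra). lra.
Qed.

(** The displacement is [p - q * eps], from which irrationality of [eps] reads off [p] and [q]. The
    start is on the discontinuity, the end is [e] to the left of it. *)
Lemma tip_word_crossing : crossing (tip_word N b p p' s t) b p q t s.
Proof.
  assert (Q := tip_q_pos). assert (E := tip_e_bounds).
  destruct tip_admissible as (A1 & A2 & A3 & A4 & A5).
  assert (Ht : (t + s < N)%nat) by apply V.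
  assert (D := realizes_displacement _ _ _ _ t (t + s) tip_word_realizes
                 ltac:(rewrite tip_word_length; lia) ltac:(rewrite tip_word_length; lia)).
  rewrite tip_word_return, tip_word_start in D.
  assert (D' : IZR p - IZR q * eps =
    IZR (wraps (tip_word N b p p' s t) (t + s) - wraps (tip_word N b p p' s t) t)
    - IZR (steps (tip_word N b p p' s t) (t + s) - steps (tip_word N b p p' s t) t) * eps)
    by lra.
  apply irrational_linear_inj in D' as [D1 D2]; [|exact A2].
  split; [rewrite tip_word_length; exact Ht|].
  split; [lia|]. split; [lia|].
  rewrite !tip_word_nth by lia. split.
  - apply Bool.not_true_is_false. rewrite below_code3 by exact A5.
    rewrite tip_word_start. lra.
  - apply below_code3; [exact A5|]. rewrite tip_word_return, tip_eps_eq.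
    replace (IZR q * ((IZR p + e) / IZR q)) with (IZR p + e) by (field; lra). lra.
Qed.

End TipWord.

(** * Recovering the parameters from the word *)

Lemma IZR_lt_add_small (a b : Z) (x : R) : x < 1 -> IZR a < IZR b + x -> (a <= b)%Z.
Proof.
  intros Hx H. apply Z.lt_succ_r, lt_IZR. rewrite succ_IZR. lra.
Qed.

(* The crossing forces [eps > p2 / q2] where [eps = p1 / (p1 + p1') + tilt N], and
   the tilt is too small to change the order of two fractions with denominators
   at most [2 N]. *)
Lemma tip_word_crossing_slope N b1 p1 p1' s1 t1 b2 p2 q2 t2 s2 :
  valid N p1 p1' s1 t1 -> (0 < q2 <= 2 * Z.of_nat N)%Z ->
  crossing (tip_word N b1 p1 p1' s1 t1) b2 p2 q2 t2 s2 ->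
  (p2 * (p1 + p1') <= p1 * q2)%Z.
Proof.
  intros V Hq2 C.
  assert (A := tip_admissible N b1 p1 p1' s1 t1 V).
  assert (Q := tip_q_pos N p1 p1' s1 t1 V).
  destruct (crossing_position _ _ _ _ _ _ _ _ _ ltac:(apply A)
              (tip_word_realizes N b1 p1 p1' s1 t1 V) C) as [H1 H2].
  assert (H : IZR p2 < IZR q2 * tip_eps N p1 (p1 + p1')) by lra.
  destruct V as (? & ? & ? & ? & ?).
  apply IZR_lt_add_small with (IZR (q2 * (p1 + p1')) * tilt N).
  { assert (S := tilt_small N (q2 * (p1 + p1'))%Z ltac:(lia) ltac:(nia)). lra. }
  rewrite !mult_IZR. apply Rmult_lt_compat_r with (r := IZR (p1 + p1')) in H; [|exact Q].
  unfold tip_eps in H.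
  replace (IZR q2 * (IZR p1 / IZR (p1 + p1') + tilt N) * IZR (p1 + p1'))
    with (IZR p1 * IZR q2 + IZR q2 * IZR (p1 + p1') * tilt N) in H by (field; lra).
  exact H.
Qed.

Lemma coprime_ratio_eq (a b c d : Z) :
  (0 < a)%Z -> (0 < c)%Z -> Z.gcd a b = 1%Z -> Z.gcd c d = 1%Z ->
  (a * d = c * b)%Z -> a = c /\ b = d.
Proof.
  intros Ha Hc Gab Gcd E.
  assert (D1 : (a | c)%Z).
  { apply Z.gauss with b; [exists d; lia | exact Gab]. }
  assert (D2 : (c | a)%Z).
  { apply Z.gauss with d; [exists b; lia | exact Gcd]. }
  assert (a = c) by (apply Z.divide_antisym_nonneg; lia || assumption).
  subst c. split; [reflexivity|nia].
Qed.

(** Compares the start of any crossing of slope [p / q] with the tip at index [t1]. In units of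
    [1 / q] their difference is an integer [z] congruent to [- i * p], minus a drift of at most
    [1 / 10]; the crossing window puts it just to the right of [gap], the distance between the two
    discontinuities, which is free of [eps]. *)
Lemma tip_word_displacement N b1 p p' s1 t1 b2 s2 t2 :
  valid N p p' s1 t1 ->
  crossing (tip_word N b1 p p' s1 t1) b2 p (p + p') t2 s2 ->
  let l := tip_len b1 s1 (p + p') in
  let gap := (jump b2 0 l - jump b1 0 l) * IZR (p + p') in
  let i := (steps (tip_word N b1 p p' s1 t1) t2 - steps (tip_word N b1 p p' s1 t1) t1)%Z in
  exists z : Z, (exists k : Z, z = k * (p + p') - i * p)%Z /\
    - (1 / 10) <= IZR i * (IZR (p + p') * tilt N) <= 1 / 10 /\
    gap <= IZR z - IZR i * (IZR (p + p') * tilt N)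
        < gap + IZR (p + p') * (IZR (p + p') * tilt N).
Proof.
  intros V C l gap i.
  set (w := tip_word N b1 p p' s1 t1) in *.
  set (eps := tip_eps N p (p + p')).
  set (q := (p + p')%Z) in *.
  assert (A : admissible eps l) by apply (tip_admissible N b1 p p' s1 t1 V).
  assert (Q : 0 < IZR q) by apply (tip_q_pos N p p' s1 t1 V).
  assert (W := tip_word_realizes N b1 p p' s1 t1 V).
  assert (Lw : length w = N) by apply tip_word_length.
  assert (P := crossing_position _ _ _ _ _ _ _ _ _ ltac:(apply A) W C).
  assert (C1 : (t2 + s2 < length w)%nat) by apply C.
  assert (D := realizes_displacement _ _ _ _ t1 t2 W
                 ltac:(fold w; rewrite Lw; destruct V; lia) ltac:(fold w; lia)).
  cbv beta in D.
  rewrite (tip_word_start N b1 p p' s1 t1 V) in D.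
  fold w q eps l i in D, P. cbv beta in P.
  set (k := (wraps w t2 - wraps w t1)%Z) in D.
  assert (E : IZR q * eps = IZR p + IZR q * tilt N).
  { unfold eps, tip_eps. field. lra. }
  exists (k * q - i * p)%Z. split; [exists k; reflexivity|].
  destruct V as (? & ? & ? & ? & ?).
  assert (Hi : (Z.abs i <= 2 * Z.of_nat N)%Z).
  { assert (B1 := steps_bounds w t1). assert (B2 := steps_bounds w t2). unfold i. lia. }
  split.
  - rewrite <- Rmult_assoc, <- mult_IZR. split.
    + assert (S := tilt_small N (- (i * q))%Z ltac:(lia) ltac:(unfold q; nia)).
      rewrite opp_IZR in S. lra.
    + apply tilt_small; [lia|unfold q; nia].
  - assert (J : jump b2 0 l - jump b1 0 l = jump b2 eps l - jump b1 eps l).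
    { unfold jump. destruct b1, b2; lra. }
    unfold gap. rewrite J, minus_IZR, !mult_IZR.
    replace (IZR k * IZR q - IZR i * IZR p - IZR i * (IZR q * tilt N))
      with ((IZR k - IZR i * eps) * IZR q) by (rewrite Rmult_minus_distr_r, Rmult_assoc,
             (Rmult_comm eps), E; ring).
    rewrite <- D.
    replace ((jump b2 eps l - jump b1 eps l) * IZR q + IZR q * (IZR q * tilt N))
      with ((jump b2 eps l + IZR q * eps - IZR p - jump b1 eps l) * IZR q)
      by (rewrite E; ring).
    split; [apply Rmult_le_compat_r|apply Rmult_lt_compat_r]; lra.
Qed.

(** Here [gap = 0], so [z = 0] and the window leaves [0 <= - i < q]. As [q] divides [i * p] and is
    coprime to [p], [i = 0]; strict monotonicity of [steps] then identifies both ends of the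
    crossing. *)
Lemma tip_word_crossing_same N b p p' s1 t1 s2 t2 :
  valid N p p' s1 t1 ->
  crossing (tip_word N b p p' s1 t1) b p (p + p') t2 s2 -> s1 = s2 /\ t1 = t2.
Proof.
  intros V C.
  assert (C1 := tip_word_crossing N b p p' s1 t1 V).
  destruct (tip_word_displacement _ _ _ _ _ _ _ _ _ V C) as (z & [k Hk] & H1 & H2).
  assert (Q := tip_q_pos N p p' s1 t1 V).
  assert (S := tilt_pos N ltac:(destruct V; lia)).
  set (w := tip_word N b p p' s1 t1) in *.
  set (i := (steps w t2 - steps w t1)%Z) in *.
  rewrite Rminus_diag, Rmult_0_l in H2.
  set (e := IZR (p + p') * tilt N) in *.
  assert (He : 0 < e) by (apply Rmult_lt_0_compat; assumption).
  assert (Hqe : IZR (p + p') * e <= 1 / 10).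
  { unfold e. rewrite <- Rmult_assoc, <- mult_IZR. destruct V as (? & ? & ? & ? & ?).
    apply tilt_small; nia. }
  assert (Hz : z = 0%Z).
  { apply Z.le_antisymm; apply Z.lt_succ_r, lt_IZR; rewrite succ_IZR; lra. }
  rewrite Hz in H2.
  assert (Hi1 : (i <= 0)%Z).
  { apply le_IZR. apply Rmult_le_reg_r with e; lra. }
  assert (Hi2 : (- i < p + p')%Z).
  { apply lt_IZR. rewrite opp_IZR. apply Rmult_lt_reg_r with e; lra. }
  destruct V as (? & ? & ? & G & ?).
  assert (D : (p + p' | - i)%Z).
  { apply Z.gauss with p; [exists (- k)%Z; lia|].
    rewrite Z.gcd_comm, Z.add_comm, Z.gcd_add_diag_r. exact G. }
  assert (Hi : i = 0%Z).
  { destruct (Z.eq_dec i 0) as [|Hn]; [assumption|].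
    apply Z.divide_pos_le in D; lia. }
  assert (Ht : t2 = t1) by (apply (steps_inj w); unfold i in Hi; lia).
  subst t2. split; [|reflexivity].
  destruct C as (_ & _ & Cq & _), C1 as (_ & _ & Cq1 & _).
  enough (t1 + s1 = t1 + s2)%nat by lia.
  apply (steps_inj w). fold w in Cq1. lia.
Qed.

(** Now [gap] is a half-integer, and no integer [z] lies within the drift and the window of it. *)
Lemma tip_word_crossing_other N p p' s1 t1 s2 t2 :
  valid N p p' s1 t1 ->
  ~ crossing (tip_word N true p p' s1 t1) false p (p + p') t2 s2.
Proof.
  intros V C.
  destruct (tip_word_displacement _ _ _ _ _ _ _ _ _ V C) as (z & _ & H1 & H2).
  assert (Q := tip_q_pos N p p' s1 t1 V).
  set (e := IZR (p + p') * tilt N) in *.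
  assert (Hqe : IZR (p + p') * e <= 1 / 10).
  { unfold e. rewrite <- Rmult_assoc, <- mult_IZR. destruct V as (? & ? & ? & ? & ?).
    apply tilt_small; nia. }
  unfold jump, tip_len in H2.
  replace (((INR s1 + - (1 / 2)) / IZR (p + p') - 1 + 0 - 0) * IZR (p + p'))
    with (IZR (Z.of_nat s1 - (p + p')) - 1 / 2) in H2
    by (rewrite minus_IZR, <- INR_IZR_INZ; field; lra).
  assert (L1 : (z <= Z.of_nat s1 - (p + p'))%Z).
  { apply IZR_lt_add_small with (- (1 / 2) + 3 / 10); lra. }
  assert (L2 : (Z.of_nat s1 - (p + p') <= z)%Z).
  { apply IZR_lt_add_small with (7 / 10); lra. }
  assert (L : z = (Z.of_nat s1 - (p + p'))%Z) by lia. rewrite L in H2. lra.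
Qed.

(** The common word carries both crossings. Comparing slopes in both directions gives equal
    fractions in lowest terms; then the discontinuity, and finally the two times, must agree. *)
Lemma tip_word_inj N b1 p1 p1' s1 t1 b2 p2 p2' s2 t2 :
  valid N p1 p1' s1 t1 -> valid N p2 p2' s2 t2 ->
  tip_word N b1 p1 p1' s1 t1 = tip_word N b2 p2 p2' s2 t2 ->
  b1 = b2 /\ p1 = p2 /\ p1' = p2' /\ s1 = s2 /\ t1 = t2.
Proof.
  intros V1 V2 W.
  assert (C1 := tip_word_crossing N b1 p1 p1' s1 t1 V1). rewrite W in C1.
  assert (C2 := tip_word_crossing N b2 p2 p2' s2 t2 V2). rewrite <- W in C2.
  assert (E : p1 = p2 /\ p1' = p2').
  { assert (Q1 : (0 < p1 + p1' <= 2 * Z.of_nat N)%Z) by (unfold valid in V1; lia).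
    assert (Q2 : (0 < p2 + p2' <= 2 * Z.of_nat N)%Z) by (unfold valid in V2; lia).
    assert (L1 := tip_word_crossing_slope _ _ _ _ _ _ _ _ _ _ _ V1 Q2 C2).
    assert (L2 := tip_word_crossing_slope _ _ _ _ _ _ _ _ _ _ _ V2 Q1 C1).
    destruct V1 as (? & ? & _ & ? & _), V2 as (? & ? & _ & ? & _).
    apply coprime_ratio_eq; [lia|lia|assumption|assumption|lia]. }
  destruct E as [<- <-].
  assert (b1 = b2) as <-.
  { destruct b1, b2; try reflexivity; exfalso.
    - exact (tip_word_crossing_other _ _ _ _ _ _ _ V1 C2).
    - exact (tip_word_crossing_other _ _ _ _ _ _ _ V2 C1). }
  destruct (tip_word_crossing_same _ _ _ _ _ _ _ _ V1 C2) as [<- <-].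
  auto.
Qed.

(** * Counting in lists of dependent pairs *)

Definition sigma_list {A B} (l : list A) (f : A -> list B) : list (A * B) :=
  flat_map (fun a => map (pair a) (f a)) l.

Lemma in_sigma_list {A B} (l : list A) (f : A -> list B) a b :
  In (a, b) (sigma_list l f) <-> In a l /\ In b (f a).
Proof.
  unfold sigma_list. rewrite in_flat_map. split.
  - intros (x & Hx & H). apply in_map_iff in H as (y & E & Hy).
    injection E as -> ->. auto.
  - intros [Ha Hb]. exists a. split; [exact Ha|]. apply in_map, Hb.
Qed.

Lemma NoDup_sigma_list {A B} (l : list A) (f : A -> list B) :
  NoDup l -> (forall a, NoDup (f a)) -> NoDup (sigma_list l f).
Proof.
  intros Hl Hf. induction Hl as [|a l Ha Hl IH]; [constructor|].
  cbn [sigma_list flat_map]. apply NoDup_app; [|exact IH|].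
  - apply NoDup_map_NoDup_ForallPairs; [|apply Hf].
    intros x y _ _ E. congruence.
  - intros [a' b] H1 H2. apply in_map_iff in H1 as (y & E & _).
    injection E as <- <-. apply (in_sigma_list l f) in H2. tauto.
Qed.

Lemma length_filter_sigma_list {A B} (g : A * B -> bool) (l : list A) (f : A -> list B) :
  length (filter g (sigma_list l f)) =
  list_sum (map (fun a => length (filter (fun b => g (a, b)) (f a))) l).
Proof.
  induction l as [|a l IH]; [reflexivity|].
  cbn [sigma_list flat_map map]. rewrite filter_app, length_app.
  fold (sigma_list l f). rewrite IH. simpl. f_equal.
  induction (f a) as [|b r IHr]; [reflexivity|].
  simpl. destruct (g (a, b)); simpl; congruence.
Qed.

Lemma length_sigma_list {A B} (l : list A) (f : A -> list B) :
  length (sigma_list l f) = list_sum (map (fun a => length (f a)) l).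
Proof.
  induction l as [|a l IH]; [reflexivity|].
  cbn [sigma_list flat_map map]. rewrite length_app, length_map.
  fold (sigma_list l f). rewrite IH. reflexivity.
Qed.

Lemma list_sum_cons (a : nat) (l : list nat) : list_sum (a :: l) = (a + list_sum l)%nat.
Proof. reflexivity. Qed.

Lemma list_sum_map_le {A} (f g : A -> nat) (l : list A) :
  (forall a, In a l -> (f a <= g a)%nat) ->
  (list_sum (map f l) <= list_sum (map g l))%nat.
Proof.
  induction l as [|a l IH]; intros H; [apply Nat.le_refl|].
  cbn [map]; rewrite !list_sum_cons. apply Nat.add_le_mono; [apply H; left; reflexivity|].
  apply IH. intros b Hb. apply H. right. exact Hb.
Qed.

Lemma list_sum_seq_S (f : nat -> nat) a n :
  list_sum (map f (seq a (S n))) = (list_sum (map f (seq a n)) + f (a + n))%nat.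
Proof.
  rewrite seq_S, map_app, list_sum_app. simpl. lia.
Qed.

(** Union bound: an element failing [P] is counted by at least one [Q i]. *)
Lemma length_filter_union {A I} (P : A -> bool) (Q : I -> A -> bool) (is : list I) (l : list A) :
  (forall a, In a l -> P a = true \/ exists i, In i is /\ Q i a = true) ->
  (length l <= length (filter P l) + list_sum (map (fun i => length (filter (Q i) l)) is))%nat.
Proof.
  induction l as [|a l IH]; intros H; [simpl; lia|].
  assert (IH' := IH (fun b Hb => H b (or_intror Hb))).
  assert (M : (list_sum (map (fun i => length (filter (Q i) l)) is) <=
               list_sum (map (fun i => length (filter (Q i) (a :: l))) is))%nat).
  { apply list_sum_map_le. intros i _. simpl. destruct (Q i a); simpl; lia. }
  assert (F : length (filter P (a :: l)) = ((if P a then 1 else 0) + length (filter P l))%nat)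
    by (simpl; destruct (P a); reflexivity).
  rewrite F. cbn [length].
  destruct (H a (or_introl eq_refl)) as [HP|(i & Hi & HQ)]; [rewrite HP; lia|].
  enough (list_sum (map (fun i => length (filter (Q i) l)) is) <
          list_sum (map (fun i => length (filter (Q i) (a :: l))) is))%nat by lia.
  clear - Hi HQ. induction is as [|j r IH]; [destruct Hi|].
  cbn [map]; rewrite !list_sum_cons.
  destruct Hi as [->|Hi].
  + assert (M : (list_sum (map (fun i => length (filter (Q i) l)) r) <=
             list_sum (map (fun i => length (filter (Q i) (a :: l))) r))%nat).
    { apply list_sum_map_le. intros k _. simpl. destruct (Q k a); simpl; lia. }
    assert (E : length (filter (Q i) (a :: l)) = S (length (filter (Q i) l)))
      by (simpl; rewrite HQ; reflexivity).
    lia.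
  + assert (E : (length (filter (Q j) l) <= length (filter (Q j) (a :: l)))%nat)
      by (simpl; destruct (Q j a); simpl; lia).
    specialize (IH Hi). lia.
Qed.

(** * Coprime pairs in a triangle *)

Lemma div_succ (n d : nat) :
  (0 < d)%nat -> (S n / d = n / d + if S n mod d =? 0 then 1 else 0)%nat.
Proof.
  intros Hd.
  assert (E := Nat.div_mod n d ltac:(lia)). assert (B := Nat.mod_upper_bound n d ltac:(lia)).
  destruct (Nat.eq_dec (S (n mod d)) d) as [H|H].
  - assert (S n = d * S (n / d) + 0)%nat as E' by lia.
    rewrite <- (Nat.div_unique (S n) d (S (n / d)) 0), <- (Nat.mod_unique (S n) d (S (n / d)) 0)
      by lia.
    simpl. lia.
  - rewrite <- (Nat.div_unique (S n) d (n / d) (S (n mod d))) by lia.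
    rewrite <- (Nat.mod_unique (S n) d (n / d) (S (n mod d))) by lia.
    simpl. lia.
Qed.

Lemma length_filter_multiples (d a k : nat) :
  (0 < d)%nat ->
  (length (filter (fun x => x mod d =? 0) (seq (S a) k)) + a / d = (a + k) / d)%nat.
Proof.
  intros Hd. induction k as [|k IH]; [rewrite Nat.add_0_r; reflexivity|].
  rewrite seq_S, filter_app, length_app, Nat.add_succ_r, div_succ by exact Hd.
  cbn [filter Nat.add]. destruct (S (a + k) mod d =? 0); cbn [length]; lia.
Qed.

Lemma sum_multiples (d m : nat) :
  (0 < d)%nat ->
  (2 * list_sum (map (fun p => if p mod d =? 0 then p / d else 0) (seq 1 m)) =
   m / d * (m / d + 1))%nat.
Proof.
  intros Hd. induction m as [|m IH]; [rewrite Nat.Div0.div_0_l; reflexivity|].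
  rewrite list_sum_seq_S, Nat.mul_add_distr_l, IH.
  cbn [Nat.add]. rewrite !div_succ by exact Hd.
  destruct (S m mod d =? 0); nia.
Qed.

(** With [s = m + 1], the pairs with [p, p' < s < p + p']. *)
Definition triangle (m : nat) : list (nat * nat) :=
  sigma_list (seq 1 m) (fun p => seq (S (m + 1 - p)) (p - 1)).

Definition coprime_pairs (m : nat) : list (nat * nat) :=
  filter (fun x => Nat.gcd (fst x) (snd x) =? 1) (triangle m).

Lemma in_triangle (m p p' : nat) :
  In (p, p') (triangle m) -> (1 <= p <= m /\ 1 <= p' <= m /\ m + 2 <= p + p')%nat.
Proof.
  unfold triangle. rewrite in_sigma_list, !in_seq. lia.
Qed.

Lemma length_triangle (m : nat) : (2 * length (triangle m) + m = m * m)%nat.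
Proof.
  unfold triangle. rewrite length_sigma_list.
  assert (G : forall k, (2 * list_sum (map (fun p => length (seq (S (m + 1 - p)) (p - 1))) (seq 1 k))
                + k = k * k)%nat).
  { induction k as [|k IH]; [reflexivity|].
    rewrite list_sum_seq_S, length_seq. nia. }
  apply G.
Qed.

Definition both_divisible (d : nat) (x : nat * nat) : bool :=
  (fst x mod d =? 0)%nat && (snd x mod d =? 0)%nat.

(** If [d] divides [p], the row of [p] has at most [p / d] multiples of [d]; these bounds sum to a
    triangular number. *)
Lemma length_triangle_multiples (d m : nat) :
  (0 < d)%nat ->
  (2 * length (filter (both_divisible d) (triangle m)) <= m / d * (m / d + 1))%nat.
Proof.
  intros Hd. rewrite <- (sum_multiples d m Hd).
  apply Nat.mul_le_mono_l. unfold triangle. rewrite length_filter_sigma_list.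
  apply list_sum_map_le. intros p Hp. apply in_seq in Hp.
  unfold both_divisible. cbn [fst snd].
  destruct (Nat.eqb_spec (p mod d) 0) as [H|H]; cbn [andb].
  - assert (E := length_filter_multiples d (m + 1 - p) (p - 1) Hd).
    replace (m + 1 - p + (p - 1))%nat with m in E by lia.
    assert (Ep := Nat.div_mod p d ltac:(lia)). rewrite H in Ep.
    assert (Em : (m / d = (m - p) / d + p / d)%nat).
    { rewrite <- Nat.div_add by lia. f_equal. lia. }
    assert (L : ((m - p) / d <= (m + 1 - p) / d)%nat) by (apply Nat.Div0.div_le_mono; lia).
    lia.
  - induction (seq _ _); [apply Nat.le_refl|assumption].
Qed.

(** 2 and all odd numbers from 3 to [2 * m + 1]. Using odd numbers rather than odd primes only
    overcounts, and an odd gcd can serve as its own modulus. *)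
Definition sieve_moduli (m : nat) : list nat := 2%nat :: map (fun j => (2 * j + 3)%nat) (seq 0 m).

Lemma length_triangle_sieve (m : nat) :
  (length (triangle m) <= length (coprime_pairs m) +
     list_sum (map (fun d => length (filter (both_divisible d) (triangle m))) (sieve_moduli m)))%nat.
Proof.
  apply length_filter_union. intros [p p'] H. apply in_triangle in H. cbn [fst snd].
  destruct (Nat.eqb_spec (Nat.gcd p p') 1) as [G|G]; [left; reflexivity|right].
  assert (D1 := Nat.gcd_divide_l p p'). assert (D2 := Nat.gcd_divide_r p p').
  set (g := Nat.gcd p p') in *.
  assert (Hg0 : g <> 0%nat) by (destruct D1 as [k Hk]; lia).
  assert (Hgm : (g <= m)%nat) by (apply Nat.divide_pos_le in D1; lia).
  assert (Hd : forall d, d <> 0%nat -> Nat.divide d g -> both_divisible d (p, p') = true).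
  { intros d Hd Dg. unfold both_divisible. cbn [fst snd].
    apply andb_true_intro. split; apply Nat.eqb_eq, Nat.Lcm0.mod_divide;
      eapply Nat.divide_trans; eassumption. }
  destruct (Nat.Even_or_Odd g) as [[k Hk]|[k Hk]].
  - exists 2%nat. split; [left; reflexivity|]. apply Hd; [lia|]. exists k. lia.
  - exists g. split; [right|apply Hd; [lia|apply Nat.divide_refl]].
    apply in_map_iff. exists (k - 1)%nat. split; [lia|]. apply in_seq. lia.
Qed.

Lemma sum_odd_inverse_squares (f : nat -> nat) (a b : R) (k : nat) :
  0 <= a ->
  (forall j, (j < k)%nat -> INR (f j) <= a / (2 * INR j + 3) ^ 2 + b) ->
  INR (list_sum (map f (seq 0 k))) <= a * (1 / 4 - 1 / (4 * (INR k + 1))) + INR k * b.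
Proof.
  intros Ha. induction k as [|k IH]; intros H; [simpl; lra|].
  rewrite list_sum_seq_S, plus_INR, S_INR.
  assert (H1 := IH ltac:(intros; apply H; lia)).
  assert (H2 := H k ltac:(lia)). cbn [Nat.add].
  assert (P := pos_INR k). set (x := INR k) in *.
  (* Telescoping, from [(2 * x + 3) ^ 2 = 4 * (x + 1) * (x + 2) + 1]. *)
  assert (T : 1 / (2 * x + 3) ^ 2 <= 1 / (4 * (x + 1)) - 1 / (4 * (x + 1 + 1))).
  { replace (1 / (4 * (x + 1)) - 1 / (4 * (x + 1 + 1)))
      with (1 / (4 * (x + 1) * (x + 2))) by (field; lra).
    unfold Rdiv. rewrite !Rmult_1_l. apply Rinv_le_contravar; nra. }
  apply Rmult_le_compat_l with (r := a) in T; [|exact Ha].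
  replace (a / (2 * x + 3) ^ 2) with (a * (1 / (2 * x + 3) ^ 2)) in H2 by (field; lra).
  lra.
Qed.

Lemma INR_length_triangle_multiples (d m : nat) :
  (0 < d)%nat ->
  INR (length (filter (both_divisible d) (triangle m)))
    <= (INR m / INR d * (INR m / INR d + 1)) / 2.
Proof.
  intros Hd. assert (H := length_triangle_multiples d m Hd).
  apply le_INR in H. rewrite !mult_INR, plus_INR in H. simpl in H.
  assert (D : 0 < INR d) by (apply lt_0_INR, Hd).
  assert (B : INR (m / d) <= INR m / INR d).
  { apply Rmult_le_reg_r with (INR d); [exact D|].
    unfold Rdiv. rewrite Rmult_assoc, Rinv_l, Rmult_1_r by lra.
    rewrite <- mult_INR. apply le_INR. rewrite Nat.mul_comm. apply Nat.Div0.mul_div_le. }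
  assert (P := pos_INR (m / d)). nra.
Qed.

(** The sieve leaves [m ^ 2 / 2 * (1 - 1/4 - 1/4)]. The linear terms [m / (2 * d)] would add up to
    [m * ln m]; they are instead split into [m / 128 + 32 * m / d ^ 2], which costs [m ^ 2 / 128]
    and gives [1/4 - 1/128 = 31/128]. *)
Lemma length_coprime_pairs (m : nat) :
  31 / 128 * INR m ^ 2 - 9 * INR m <= INR (length (coprime_pairs m)).
Proof.
  assert (H := length_triangle_sieve m). assert (T := length_triangle m).
  unfold sieve_moduli in H. cbn [map] in H; rewrite list_sum_cons in H. rewrite map_map in H.
  set (f := fun j => length (filter (both_divisible (2 * j + 3)) (triangle m))) in H.
  apply le_INR in H. rewrite !plus_INR in H.
  apply (f_equal INR) in T. rewrite plus_INR, !mult_INR in T. simpl (INR 2) in T.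
  assert (H2 := INR_length_triangle_multiples 2 m ltac:(lia)). simpl (INR 2) in H2.
  assert (P := pos_INR m). set (x := INR m) in *.
  assert (S : INR (list_sum (map f (seq 0 m))) <=
    (x ^ 2 / 2 + 32 * x) * (1 / 4 - 1 / (4 * (x + 1))) + x * (x / 128)).
  { apply sum_odd_inverse_squares; [nra|]. intros j _.
    assert (B := INR_length_triangle_multiples (2 * j + 3) m ltac:(lia)).
    fold (f j) x in B. rewrite plus_INR, mult_INR in B.
    replace (INR 3) with 3 in B by (simpl; lra). simpl (INR 2) in B.
    assert (Pj := pos_INR j).
    set (d := 2 * INR j + 3) in *.
    replace (1 + 1) with 2 in B by lra. fold d in B.
    assert (D : 0 < d) by (unfold d; lra).
    (* AM-GM: [x / d <= x / 64 + 64 * x / d^2] *)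
    assert (A : x * (1 / d) <= x * (1 / 64 + 64 / d ^ 2)).
    { apply Rmult_le_compat_l; [exact P|].
      replace (1 / 64 + 64 / d ^ 2) with (1 / d + ((d - 32) ^ 2 + 3072) / (64 * d ^ 2))
        by (field; lra).
      assert (0 < ((d - 32) ^ 2 + 3072) / (64 * d ^ 2))
        by (apply Rdiv_lt_0_compat; nra).
      lra. }
    replace (x / d * (x / d + 1) / 2) with (x ^ 2 / 2 / d ^ 2 + x * (1 / d) / 2) in B
      by (field; lra).
    replace ((x ^ 2 / 2 + 32 * x) / d ^ 2 + x / 128)
      with (x ^ 2 / 2 / d ^ 2 + x * (1 / 64 + 64 / d ^ 2) / 2) by (field; lra).
    lra. }
  assert (I : 0 <= (x ^ 2 / 2 + 32 * x) * (1 / (4 * (x + 1)))).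
  { apply Rmult_le_pos; [nra|]. left. apply Rdiv_lt_0_compat; lra. }
  nra.
Qed.

(** * Counting the words *)

Lemma Zgcd_of_nat (a b : nat) : Z.gcd (Z.of_nat a) (Z.of_nat b) = Z.of_nat (Nat.gcd a b).
Proof.
  assert (A : forall (q : Z) (n : nat), (q | Z.of_nat n)%Z -> Nat.divide (Z.abs_nat q) n).
  { intros q n [k Hk]. exists (Z.abs_nat k). rewrite <- Zabs2Nat.inj_mul, <- Hk. lia. }
  apply Z.gcd_unique.
  - lia.
  - destruct (Nat.gcd_divide_l a b) as [k Hk]. exists (Z.of_nat k). lia.
  - destruct (Nat.gcd_divide_r a b) as [k Hk]. exists (Z.of_nat k). lia.
  - intros q Ha Hb. apply A in Ha, Hb.
    destruct (Nat.gcd_greatest _ _ _ Ha Hb) as [k Hk].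
    apply Z.divide_abs_l. exists (Z.of_nat k). lia.
Qed.

(** The index [m] stands for [s - 1], so [t < N - 1 - m] means [t + s < N]. *)
Definition tips (N : nat) : list (nat * ((nat * nat) * (bool * nat))) :=
  sigma_list (seq 0 N) (fun m => sigma_list (coprime_pairs m)
    (fun _ => sigma_list (true :: false :: nil) (fun _ => seq 0 (N - 1 - m)))).

Definition word_of_tip (N : nat) (x : nat * ((nat * nat) * (bool * nat))) : list letter :=
  match x with (m, ((p, p'), (b, t))) =>
    tip_word N b (Z.of_nat p) (Z.of_nat p') (S m) t end.

Lemma NoDup_tips (N : nat) : NoDup (tips N).
Proof.
  apply NoDup_sigma_list; [apply seq_NoDup|]. intros m.
  apply NoDup_sigma_list; [|intros _; apply NoDup_sigma_list].
  - apply NoDup_filter, NoDup_sigma_list; intros; apply seq_NoDup.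
  - repeat constructor; simpl; intuition discriminate.
  - intros _. apply seq_NoDup.
Qed.

Lemma valid_tips (N m p p' t : nat) (b : bool) :
  In (m, ((p, p'), (b, t))) (tips N) -> valid N (Z.of_nat p) (Z.of_nat p') (S m) t.
Proof.
  unfold tips, coprime_pairs. rewrite !in_sigma_list, filter_In, !in_seq.
  intros (Hm & (Ht & G) & _ & Hn). apply in_triangle in Ht.
  apply Nat.eqb_eq in G. cbn [fst snd] in G.
  unfold valid. rewrite Zgcd_of_nat, G. lia.
Qed.

(** The leading coefficient is [2 * 31/128 * (1/3 - 1/4)], from summing [(N - m) * m ^ 2]. *)
Lemma length_tips (N : nat) :
  31 / 768 * INR N ^ 4 - 4 * INR N ^ 3 <= INR (length (tips N)).
Proof.
  unfold tips. rewrite length_sigma_list.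
  set (f := fun m => _).
  assert (Hf : forall m, (m < N)%nat ->
    2 * (INR N - 1 - INR m) * (31 / 128 * INR m ^ 2 - 9 * INR m) <= INR (f m)).
  { intros m Hm. unfold f. rewrite length_sigma_list.
    assert (C := length_coprime_pairs m).
    assert (E : forall r : list (nat * nat),
      list_sum (map (fun _ => length (sigma_list (true :: false :: nil) (fun _ => seq 0 (N - 1 - m)))) r)
        = (length r * (2 * (N - 1 - m)))%nat).
    { induction r as [|a r IH]; [reflexivity|].
      cbn [map length]. rewrite list_sum_cons.
      rewrite IH, length_sigma_list. cbn. rewrite length_seq. lia. }
    rewrite E, !mult_INR, !minus_INR by lia. simpl (INR 2). simpl (INR 1).
    assert (M : INR m + 1 <= INR N) by (rewrite <- S_INR; apply le_INR; lia).
    rewrite Rmult_comm. replace (1 + 1) with 2 by lra.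
    apply Rmult_le_compat_r; lra. }
  (* Closed forms for the sums of [m], [m ^ 2] and [m ^ 3] below [k], with [N] kept fixed during the
     induction. *)
  assert (G : forall k, (k <= N)%nat ->
    31 / 128 * (2 * (INR N - 1) * ((INR k - 1) * INR k * (2 * INR k - 1) / 6)
                - 2 * (INR k ^ 2 * (INR k - 1) ^ 2 / 4))
    - 9 * (2 * (INR N - 1) * (INR k * (INR k - 1) / 2)
           - 2 * ((INR k - 1) * INR k * (2 * INR k - 1) / 6))
    <= INR (list_sum (map f (seq 0 k)))).
  { induction k as [|k IH]; intros Hk; [simpl; lra|].
    rewrite list_sum_seq_S, plus_INR, S_INR. cbn [Nat.add].
    assert (H1 := IH ltac:(lia)). assert (H2 := Hf k ltac:(lia)). lra. }
  eapply Rle_trans; [|apply (G N (Nat.le_refl N))].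
  destruct N as [|N]; [simpl; lra|].
  assert (1 <= INR (S N)) by (rewrite S_INR; assert (P := pos_INR N); lra).
  set (x := INR (S N)) in *. nra.
Qed.

Theorem mainTheorem2 :
  forall delta : R, 0 < delta ->
  exists K : R, 0 < K /\
    forall (N : nat) (ws : list (list letter)),
      (1 <= N)%nat -> enumerates_3iet N ws ->
      INR (length ws) >=
        17 / (48 * PI ^ 2) * INR N ^ 4 - K * Rpower (INR N) (3 + delta).
Proof.
  (* 4 is the coefficient of [N ^ 3] in [length_tips], and [N ^ 3 <= N ^ (3 + delta)]. *)
  intros delta Hdelta. exists 4. split; [lra|].
  intros N ws HN [_ Hws].
  assert (L : (length (tips N) <= length ws)%nat).
  { rewrite <- (length_map (word_of_tip N)). apply NoDup_incl_length.
    - apply NoDup_map_NoDup_ForallPairs; [|apply NoDup_tips].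
      intros (m1 & (p1 & p1') & b1 & t1) (m2 & (p2 & p2') & b2 & t2) H1 H2 E.
      apply valid_tips in H1, H2. cbn [word_of_tip] in E.
      apply tip_word_inj in E as (-> & Ep & Ep' & Es & ->); [|assumption|assumption].
      apply Nat2Z.inj in Ep, Ep'. injection Es as ->. subst. reflexivity.
    - intros w Hw. apply in_map_iff in Hw as ((m & (p & p') & b & t) & <- & H).
      apply valid_tips in H. apply Hws. cbn [word_of_tip].
      split; [apply tip_word_factor, H|apply tip_word_length]. }
  apply le_INR in L.
  assert (C := length_tips N).
  assert (X : 1 <= INR N) by (apply (le_INR 1), HN).
  assert (P : INR N ^ 3 <= Rpower (INR N) (3 + delta)).
  { rewrite <- Rpower_pow by lra. apply Rle_Rpower; simpl; lra. }
  (* [PI >= 3] suffices, since [17/432 < 31/768]. *)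
  assert (Q : 17 / (48 * PI ^ 2) <= 31 / 768).
  { assert (PI3 := PI2_3_2).
    apply Rle_trans with (17 / (48 * 3 ^ 2)); [|lra].
    assert (S : 3 ^ 2 <= PI ^ 2) by (apply pow_incr; lra).
    apply Rmult_le_compat_l; [lra|]. apply Rinv_le_contravar; lra. }
  assert (F : 0 <= INR N ^ 4) by (apply pow_le; lra).
  apply Rmult_le_compat_r with (r := INR N ^ 4) in Q; [|exact F].
  lra.
Qed.
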